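(* For every $\tau\in\mathbb{Z}$, every integer $m\geq 1$ and every integer $l\geq 0$, the number \[ n_{m,l}(\tau)=\sum_{d\mid m,\ d\mid l}\frac{\mu(d)}{d^2}\,c_{\frac{m}{d},\frac{l}{d}}(\tau),\qquad c_{m,l}(\tau)=-\frac{(-1)^{m\tau+m+l}}{m^2}\binom{m}{l}\binom{m\tau+l-1}{m-1}, \] is an integer.
   Context: $\mu$ denotes the Möbius function; the sum runs over positive integers $d$ dividing both $m$ and $l$ (when $l=0$, every divisor $d$ of $m$ divides $l$). Binomial coefficients are used for all integer top arguments: for $n\geq 0$, $\binom{n}{k}$ is the usual binomial coefficient (zero if $k>n$), and for $n<0$ and $k\geq 0$ one sets $\binom{n}{k}=(-1)^k\binom{-n+k-1}{k}$. (These numbers are the genus-zero one-hole LMOV invariants of the resolved conifold with one Aganagic–Vafa brane in framing $\tau$.) *)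

(* Defs.v *)
From mathcomp Require Import all_boot all_order all_algebra.
Set Implicit Arguments. Unset Strict Implicit. Unset Printing Implicit Defensive.
Import Order.TTheory GRing.Theory Num.Theory.
Local Open Scope ring_scope.

Definition moebius (n : nat) : int :=
  if all (fun p => logn p n == 1%N) (primes n)
  then (-1) ^+ size (primes n) else 0.

Definition binz (n : int) (k : nat) : int :=
  match n with
  | Posz n' => ('C(n', k))%:Z
  | Negz n' => (-1) ^+ k * ('C(n'.+1 + k - 1, k))%:Z
  end.

Definition c_coef (tau : int) (m l : nat) : rat :=
  - ((-1) ^ (m%:Z * tau + m%:Z + l%:Z)) / (m%:R ^+ 2)
  * ('C(m, l))%:R * (binz (m%:Z * tau + l%:Z - 1) (m.-1))%:~R.

Definition n_inv (tau : int) (m l : nat) : rat :=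
  \sum_(d <- divisors m | (d %| l)%N)
     (moebius d)%:~R / (d%:R ^+ 2) * c_coef tau (m %/ d) (l %/ d).

(* Main.v *)
(* Up to sign, [m^2 n_inv tau m l] is the sum over [d | gcd(m, l)] of
   [mu(d) f(m/d, l/d)] with
     [f(m, l) = (-1)^(N + m) C(m, l) C(N - 1, m - 1)] and [N = m tau + l],
   so for each prime [p] with [p^a || m] the sum must be divisible by [p^(2a)].
   If [p] does not divide [l], both binomials of every term with [p] not
   dividing [d] are divisible by [p^a].  Otherwise the terms of [d] and [p d] are
   paired, and it suffices that [f(m, l) = f(m/p, l/p)] modulo [p^(2a)].  Let
   [e = min(a, v_p(l))].  Both binomials of [f(m/p, l/p)] are divisible by
   [p^(a-e)], and the quotient of [C(x - 1, n - 1)] by [C(x/p - 1, n/p - 1)] is the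
   product of the [(x - k)/k] over the [k < n] prime to [p].  Pairing [k] with
   [n - k], the identity [(x - k)(x - n + k) = x (x - n) + k (n - k)] shows that it
   is [1] modulo [p^(2e)], up to a sign when [p = 2] and [n = 2] modulo [4]. *)

Require Import Defs.
From mathcomp Require Import all_boot all_order all_algebra.
From mathcomp Require Import zify ring.
Import Order.TTheory GRing.Theory Num.Theory.
Local Open Scope ring_scope.

(** * Binomial coefficients with integer top as falling products *)

Lemma binz_ffact (x : int) (k : nat) :
  binz x k * (k`!)%:Z = \prod_(0 <= i < k) (x - i%:Z).
Proof.
case: x => n.
  rewrite /binz -PoszM bin_ffact; elim: k => [|k IHk]; first by rewrite big_nil.
  rewrite big_nat_recr //= -IHk ffactnSr PoszM.
  have [le_kn | lt_nk] := leqP k n; first by rewrite -subzn.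
  by rewrite ffact_small // !mul0r.
(* [Negz n] is [-(n + 1)], so the binomial is [C(n + k, k)]; each factor [-(n + 1) - k] contributes
   one sign. *)
rewrite /binz addSn subn1 /= -mulrA -PoszM bin_ffact.
elim: k => [|k IHk]; first by rewrite big_nil mulr1.
rewrite big_nat_recr //= -IHk addnS ffactSS PoszM exprS NegzE.
rewrite (_ : Posz (n + k).+1 = n%:Z + k%:Z + 1); last lia.
by rewrite (_ : Posz n.+1 = n%:Z + 1); [ring | lia].
Qed.

Lemma binz_pred_fact (x : int) (n : nat) : (0 < n)%N ->
  binz (x - 1) n.-1 * (n.-1`!)%:Z = \prod_(1 <= k < n) (x - k%:Z).
Proof.
case: n => // n _; rewrite binz_ffact big_add1 /=.
by apply: eq_bigr => i _; lia.
Qed.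

Lemma mul_binz_diag (x : int) (n : nat) : (0 < n)%N ->
  x * binz (x - 1) n.-1 = n%:Z * binz x n.
Proof.
move=> n_gt0; have fact_neq0 : (n.-1`!)%:Z != 0 by rewrite eqz_nat -lt0n fact_gt0.
apply: (mulIf fact_neq0); rewrite -mulrA binz_pred_fact //.
case: n n_gt0 fact_neq0 => // n _ _ /=.
transitivity (binz x n.+1 * (n.+1`!)%:Z); last by rewrite factS PoszM; ring.
by rewrite binz_ffact [RHS]big_ltn // subr0.
Qed.

(** * Removing the multiples of [p] from factorials *)

Lemma prod_nat_dvd_split (p n : nat) (F : nat -> int) : (0 < p)%N -> (0 < n)%N ->
  \prod_(1 <= k < p * n) F k =
  \prod_(1 <= k < p * n | ~~ (p %| k)%N) F k * \prod_(1 <= k < n) F (p * k)%N.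
Proof.
move=> p_gt0; case: n => // n _; elim: n => [|n IHn].
  rewrite muln1 [X in _ * X]big_geq // mulr1 big_nat_cond [RHS]big_nat_cond.
  apply: eq_bigl => k; rewrite andbT; symmetry; apply: andb_idr => /andP[k_gt0 lt_kp].
  by rewrite gtnNdvd.
(* The induction step appends a block of [p] consecutive indices, of which only the first is a
   multiple of [p]. *)
have le1 : (1 <= p * n.+1)%N by rewrite muln_gt0 p_gt0.
have lt2 : (p * n.+1 < p * n.+2)%N by rewrite ltn_mul2l p_gt0 /=.
rewrite (big_cat_nat (n := p * n.+1)%N) ?(ltnW lt2) //= IHn.
rewrite [in RHS](big_cat_nat (n := p * n.+1)%N) ?(ltnW lt2) //=.
rewrite [\prod_(1 <= k < n.+2) _]big_nat_recr //=.
rewrite [\prod_(p * n.+1 <= i < p * n.+2) _]big_ltn //.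
rewrite [\prod_(p * n.+1 <= k < _ | _) _]big_ltn_cond // dvdn_mulr //=.
rewrite (_ : \prod_((p * n.+1).+1 <= i < p * n.+2 | ~~ (p %| i)%N) F i =
             \prod_((p * n.+1).+1 <= i < p * n.+2) F i); first by ring.
rewrite big_nat_cond [RHS]big_nat_cond; apply: eq_bigl => k.
rewrite andbT; apply: andb_idr => /andP[lt_k k_lt]; apply/negP => /dvdnP[q def_k].
by move: lt_k k_lt; rewrite def_k (mulnC q) !ltn_mul2l p_gt0 /= ltnS ltnNge => /negP.
Qed.

(** For a prime [p] this is, up to sign, Morita's p-adic Gamma function at [n]. *)
Definition prime_to_fact (p n : nat) : int :=
  \prod_(1 <= k < n | ~~ (p %| k)%N) k%:Z.

Definition prime_to_ffact (p n : nat) (x : int) : int :=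
  \prod_(1 <= k < n | ~~ (p %| k)%N) (x - k%:Z).

(** In numerator and denominator, the multiples of [p] reproduce the smaller binomial coefficient
    once [p^(n-1)] is cancelled. The ratio is cross-multiplied to stay in [int]. *)
Lemma binz_prime_to (p n : nat) (x : int) : (0 < p)%N -> (0 < n)%N ->
  binz (p%:Z * x - 1) (p * n).-1 * prime_to_fact p (p * n) =
  binz (x - 1) n.-1 * prime_to_ffact p (p * n) (p%:Z * x).
Proof.
move=> p_gt0 n_gt0; have pn_gt0 : (0 < p * n)%N by rewrite muln_gt0 p_gt0.
have factZ r : (0 < r)%N -> (r.-1`!)%:Z = \prod_(1 <= k < r) k%:Z.
  by case: r => // r _; rewrite fact_prod (big_morph Posz PoszM (erefl _)).
have prodZ r (G : nat -> int) : \prod_(1 <= k < r) (p%:Z * G k) =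
    \prod_(1 <= k < r) p%:Z * \prod_(1 <= k < r) G k by rewrite big_split.
have q_neq0 : \prod_(1 <= k < n) p%:Z != 0.
  by rewrite prodf_seq_neq0; apply/allP => i _ /=; rewrite eqz_nat -lt0n.
have f_neq0 : (n.-1`!)%:Z != 0 by rewrite eqz_nat -lt0n fact_gt0.
apply: (mulIf (mulf_neq0 q_neq0 f_neq0)).
have := binz_pred_fact (p%:Z * x) _ pn_gt0.
rewrite factZ // !prod_nat_dvd_split //.
under [X in _ * (_ * X) = _]eq_bigr do rewrite PoszM.
under [X in _ = _ * X]eq_bigr do rewrite PoszM -mulrBr.
rewrite !prodZ -(factZ n) // -(binz_pred_fact x) // => def_binz.
transitivity (binz (p%:Z * x - 1) (p * n).-1 * (prime_to_fact p (p * n) *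
   (\prod_(1 <= k < n) p%:Z * (n.-1)`!%:Z))); first by ring.
by rewrite def_binz; ring.
Qed.

(** * Congruences for products over indices prime to [p] *)

Lemma dvdz_prodB (d : int) (a b : nat) (P : pred nat) (F G : nat -> int) :
  (forall k, (a <= k < b)%N -> P k -> (d %| F k - G k)%Z) ->
  (d %| \prod_(a <= k < b | P k) F k - \prod_(a <= k < b | P k) G k)%Z.
Proof.
move=> FG; rewrite big_nat_cond [X in _ - X]big_nat_cond.
apply: (big_ind2 (fun x y => (d %| x - y)%Z)) => [|x1 x2 y1 y2 hx hy|k /andP[]].
- by rewrite subrr dvdz0.
- rewrite (_ : _ - _ = (x1 - x2) * y1 + x2 * (y1 - y2)); last by ring.
  by apply: rpredD; [apply: dvdz_mulr | apply: dvdz_mull].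
- exact: FG.
Qed.

(* The second hypothesis says that the pairing of [k] with [n - k] has no fixed
   point among the indices. *)
Lemma prod_prime_to_half (p n : nat) (F : nat -> int) : (p %| n)%N ->
  (forall k, (2 * k)%N = n -> (p %| k)%N) ->
  \prod_(1 <= k < n | ~~ (p %| k)%N) F k =
  \prod_(1 <= k < n | ~~ (p %| k)%N && (2 * k < n)%N) (F k * F (n - k)%N).
Proof.
move=> p_n half_n; rewrite (bigID (fun k => 2 * k < n)%N) /= big_split /=.
congr (_ * _); rewrite big_nat_rev /=.
rewrite big_nat_cond [RHS]big_nat_cond.
have E k : (1 <= k < n)%N -> (1 + n - k.+1 = n - k)%N by lia.
apply: eq_big => [k|k /andP[/E-> //]].
apply: andb_id2l => rng_k; rewrite E // dvdn_subr //; last by lia.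
apply: andb_id2l => npk.
have neq : (2 * k)%N <> n by move/half_n; rewrite (negPf npk).
lia.
Qed.

(* The factors are paired by [(x - k) (x - n + k) = x (x - n) + k (n - k)]. *)
Lemma prime_to_ffact_mod (p n : nat) (x d : int) : (p %| n)%N ->
  (forall k, (2 * k)%N = n -> (p %| k)%N) -> (d %| x * (x - n%:Z))%Z ->
  (d %| prime_to_ffact p n x - prime_to_fact p n)%Z.
Proof.
move=> p_n half_n d_x; rewrite /prime_to_ffact /prime_to_fact.
rewrite prod_prime_to_half // [X in _ - X]prod_prime_to_half //.
apply: dvdz_prodB => k /andP[_ lt_kn] _.
by rewrite -subzn 1?ltnW // (_ : _ - _ = x * (x - n%:Z)) //; ring.
Qed.

Definition oddz (x : int) : bool := odd `|x|%N.

Lemma oddzD x y : oddz (x + y) = oddz x (+) oddz y.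
Proof. by rewrite /oddz; lia. Qed.

Lemma oddzM x y : oddz (x * y) = oddz x && oddz y.
Proof. by rewrite /oddz abszM oddM. Qed.

(** For odd [k], [2 x - k] is [k] modulo 4 when [x] is odd and [-k] when [x] is even; there are [n]
    such factors. *)
Lemma prime_to_ffact2_mod4 (n : nat) (x : int) :
  (4 %| prime_to_ffact 2 (2 * n) (2 * x) -
        (-1) ^+ (~~ oddz x && odd n) * prime_to_fact 2 (2 * n))%Z.
Proof.
have prod_const (s : int) : \prod_(1 <= k < 2 * n | ~~ (2 %| k)%N) s = s ^+ n.
  rewrite big_mkcond; elim: n => [|[|n] IHn]; first by rewrite big_geq.
    by rewrite muln1 big_ltn // big_geq //= mulr1.
  rewrite (_ : 2 * n.+2 = (2 * n.+1).+2)%N; last by lia.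
  have gt0 : (1 <= 2 * n.+1)%N by [].
  rewrite big_nat_recr ?(ltnW gt0) // big_nat_recr // IHn.
  by rewrite !dvdn2 oddS oddM /= mulr1 -exprSr.
have -> : (-1) ^+ (~~ oddz x && odd n) * prime_to_fact 2 (2 * n)
  = \prod_(1 <= k < 2 * n | ~~ (2 %| k)%N) ((-1) ^+ (~~ oddz x) * k%:Z) :> int.
  rewrite big_split /= prod_const; congr (_ * _).
  by rewrite -exprM -[RHS]signr_odd oddM oddb.
apply: dvdz_prodB => k _; rewrite /oddz => odd_k.
by case: (boolP (odd _)) => odd_x; rewrite ?expr0 ?expr1 ?mul1r ?mulN1r; lia.
Qed.

Lemma coprime_prime_to_fact (p n : nat) : prime p -> coprimez p (prime_to_fact p n).
Proof.
move=> p_pr; rewrite /prime_to_fact.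
apply: (big_ind (fun x => coprimez p x)) => [|x y|k npk].
- by rewrite coprimezE coprimen1.
- by rewrite coprimezMr => -> ->.
- by rewrite coprimezE prime_coprime.
Qed.

(* For odd [n] the pairing has a fixed point, but then [e = 1], so that the
   congruence modulo 4 suffices. *)
Lemma prime_to_ffact2_mod (n e : nat) (x : int) : (0 < e)%N ->
  ((2 ^ e)%N%:Z %| 2 * x)%Z -> (2 ^ e %| 2 * n)%N ->
  (((2 ^ e) ^ 2)%N%:Z %| prime_to_ffact 2 (2 * n) (2 * x) -
        (-1) ^+ (~~ oddz x && odd n) * prime_to_fact 2 (2 * n))%Z.
Proof.
move=> e_gt0 e_x e_n; have [odd_n | even_n] := boolP (odd n).
  have -> : e = 1%N; last by have := prime_to_ffact2_mod4 n x; rewrite odd_n.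
  case: e e_gt0 e_n {e_x} => // -[//|e] _; rewrite expnS dvdn_pmul2l // expnS => dvd_n.
  have : (2 %| n)%N by apply: dvdn_trans dvd_n; apply: dvdn_mulr.
  by rewrite dvdn2 odd_n.
rewrite andbF mul1r; apply: prime_to_ffact_mod.
- exact: dvdn_mulr.
- by move=> k; lia.
- rewrite -mulnn [Posz (_ ^ e * _)]PoszM; apply: dvdz_mul => //.
  by rewrite rpredB.
Qed.

Lemma prime_to_ffact_odd_mod (p n e : nat) (x : int) : prime p -> odd p ->
  ((p ^ e)%N%:Z %| x)%Z -> (p ^ e %| n)%N -> (p %| n)%N ->
  (((p ^ e) ^ 2)%N%:Z %| prime_to_ffact p n x - prime_to_fact p n)%Z.
Proof.
move=> p_pr p_odd e_x e_n p_n; apply: prime_to_ffact_mod => //.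
  by move=> k def_n; move: p_n; rewrite -def_n Gauss_dvdr // coprimen2.
by rewrite -mulnn [Posz (_ ^ e * _)]PoszM; apply: dvdz_mul => //; rewrite rpredB.
Qed.

(** * Ratio and divisibility of the two binomial coefficients *)

Lemma bin_prime_to (p m l : nat) : (0 < p)%N -> (0 < m)%N ->
  'C(p * m, p * l)%:Z * prime_to_fact p (p * l) =
  'C(m, l)%:Z * prime_to_ffact p (p * l) (p%:Z * m%:Z).
Proof.
move=> p_gt0 m_gt0; case: (posnP l) => [-> | l_gt0].
  by rewrite muln0 !bin0 /prime_to_fact /prime_to_ffact !big_geq.
have pl_gt0 : (0 < p * l)%N by rewrite muln_gt0 p_gt0.
have pl_neq0 : (p * l)%N%:Z != 0 by rewrite eqz_nat -lt0n.
(* The factor [p l] turns [C(p m, p l)] into [p m C(p m - 1, p l - 1)], to which [binz_prime_to]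
   applies. *)
apply: (mulfI pl_neq0).
have def1 := mul_binz_diag (p * m)%N%:Z _ pl_gt0.
have def2 := mul_binz_diag m%:Z _ l_gt0.
rewrite mulrA -[X in X * _]def1 -mulrA PoszM binz_prime_to //.
rewrite [in RHS]PoszM -[in RHS]mulrA [X in _ = p%:Z * X]mulrA.
by rewrite -[X in _ = p%:Z * (X * _)]def2; ring.
Qed.

Lemma dvdz_pfactor_mull (p a e : nat) (x y : int) : prime p ->
  ((p ^ a)%N%:Z %| x * y)%Z -> ~~ ((p ^ e.+1)%N%:Z %| x)%Z ->
  ((p ^ (a - e))%N%:Z %| y)%Z.
Proof.
move=> p_pr; rewrite !dvdzE !absz_nat abszM.
have [-> | y_gt0] := posnP `|y|%N; first by rewrite dvdn0.
have [-> | x_gt0] := posnP `|x|%N; first by rewrite dvdn0.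
by rewrite !pfactor_dvdn ?muln_gt0 ?x_gt0 // lognM //; lia.
Qed.

(** By absorption, [l] times the first binomial and [m tau + l] times the second are multiples of
    [m], hence of [p^a]; the multipliers absorb at most [p^e]. For [a <= e] the truncated exponent
    is 0. *)
Lemma dvdz_binomials (tau : int) (p a e m l : nat) : prime p -> (0 < m)%N ->
  (p ^ a %| m)%N -> ((e < a)%N -> ~~ (p ^ e.+1 %| l)%N) ->
  ((p ^ (a - e))%N%:Z %| 'C(m, l)%:Z)%Z /\
  ((p ^ (a - e))%N%:Z %| binz (m%:Z * tau + l%:Z - 1) m.-1)%Z.
Proof.
move=> p_pr m_gt0 a_m; have [le_ae _ | lt_ea /(_ isT) ne_l] := leqP a e.
  by rewrite (eqP le_ae) expn0 !dvd1z.
have a_mZ : ((p ^ a)%N%:Z %| m%:Z)%Z by [].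
have l_gt0 : (0 < l)%N by case: (posnP l) ne_l => // ->; rewrite dvdn0.
split.
  apply: (dvdz_pfactor_mull p a e l%:Z) => //.
  by rewrite -[X in (_ %| _ * X)%Z]/(binz m%:Z l) -mul_binz_diag // dvdz_mulr.
apply: (dvdz_pfactor_mull p a e (m%:Z * tau + l%:Z)) => //.
  by rewrite mul_binz_diag // dvdz_mulr.
(* Since [e < a], [p^(e+1)] divides [m], so it divides [m tau + l] only if it divides [l]. *)
rewrite rpredDl //; apply: dvdz_mulr; apply: dvdz_trans a_mZ.
by rewrite dvdzE !absz_nat dvdn_exp2l.
Qed.

(** * Signs, and the congruence between the terms at [(p m, p l)] and [(m, l)] *)

Definition sgnz (x : int) : int := (-1) ^+ oddz x.

(** For odd [p] both signs agree and both ratios are 1. For [p = 2] the first sign is 1, and the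
    ratios give -1 when [m] is even and [l] odd, respectively when [x] is even and [m] odd; together
    this is the parity of [x + m]. *)
Lemma sgnz_ratio (tau x : int) (p e m l : nat) : prime p -> (0 < e)%N ->
  (p ^ e %| p * m)%N -> (p ^ e %| p * l)%N -> x = m%:Z * tau + l%:Z ->
  (((p ^ e) ^ 2)%N%:Z %|
     sgnz (p%:Z * (x + m%:Z)) *
       (prime_to_ffact p (p * l) (p%:Z * m%:Z) * prime_to_ffact p (p * m) (p%:Z * x))
     - sgnz (x + m%:Z) * (prime_to_fact p (p * l) * prime_to_fact p (p * m)))%Z.
Proof.
move=> p_pr e_gt0 e_m e_l def_x.
have e_mZ : ((p ^ e)%N%:Z %| p%:Z * m%:Z)%Z by rewrite -PoszM.
have e_x : ((p ^ e)%N%:Z %| p%:Z * x)%Z.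
  by rewrite def_x mulrDr mulrA rpredD -?PoszM // dvdz_mulr.
have mulB (d s s1 s2 q1 q2 p1 p2 : int) : s = s1 * s2 ->
    (d %| q1 - s1 * p1)%Z -> (d %| q2 - s2 * p2)%Z ->
    (d %| q1 * q2 - s * (p1 * p2))%Z.
  move=> -> d1 d2.
  rewrite (_ : _ - _ = (q1 - s1 * p1) * q2 + s1 * p1 * (q2 - s2 * p2)); last by ring.
  by apply: rpredD; [apply: dvdz_mulr | apply: dvdz_mull].
have [p2 | p_odd] := even_prime p_pr.
  subst p.
  have -> : sgnz (2%:Z * (x + m%:Z)) = 1 by rewrite /sgnz oddzM.
  rewrite mul1r; apply: mulB (prime_to_ffact2_mod _ _ _ _ _ _)
    (prime_to_ffact2_mod _ _ _ _ _ _) => //.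
  rewrite /sgnz -signr_addb def_x !oddzD oddzM; rewrite /oddz !absz_nat.
  by case: (odd m) (odd l) (odd `|tau|) => [] [] [].
have -> : sgnz (p%:Z * (x + m%:Z)) = sgnz (x + m%:Z).
  by rewrite /sgnz oddzM /oddz absz_nat p_odd.
rewrite -mulrBr; apply: dvdz_mull; rewrite -[X in _ - X]mul1r.
by apply: (mulB _ _ 1 1); rewrite ?mul1r //; apply: prime_to_ffact_odd_mod => //;
  apply: dvdn_mulr.
Qed.

(** The integer [f(m, l)], equal to [-m^2 c_coef tau m l] for positive [m]. *)
Definition signed_binomials (tau : int) (m l : nat) : int :=
  sgnz (m%:Z * tau + l%:Z + m%:Z) * 'C(m, l)%:Z * binz (m%:Z * tau + l%:Z - 1) m.-1.

(** The witness is [min(a, v_p(l))], read as [a] when [l = 0], where [logn] would return 0. *)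
Lemma pfactor_min_exists (p a l : nat) : prime p ->
  exists e, [/\ (e <= a)%N, (p ^ e %| l)%N & (e < a)%N -> ~~ (p ^ e.+1 %| l)%N].
Proof.
move=> p_pr; have [-> | l_gt0] := posnP l; first by exists a; rewrite dvdn0 ltnn.
by exists (minn a (logn p l)); split; rewrite ?pfactor_dvdn //; lia.
Qed.

Lemma signed_binomials_mod (tau : int) (p a m l : nat) : prime p -> (0 < m)%N ->
  (p ^ a %| p * m)%N ->
  (((p ^ a) ^ 2)%N%:Z %|
    signed_binomials tau (p * m) (p * l) - signed_binomials tau m l)%Z.
Proof.
move=> p_pr m_gt0; have p_gt0 := prime_gt0 p_pr.
case: a => [|a a_m]; first by rewrite dvd1z.
have [e [le_ea e_l ne_l]] := pfactor_min_exists p a l p_pr.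
(* Each smaller binomial supplies [p^(a-e)] and the ratio congruence the rest; [e] belongs to
   [(m, l)], hence [e + 1] for [(p m, p l)]. *)
have def_a : ((p ^ a.+1) ^ 2 = p ^ (a - e) * p ^ (a - e) * (p ^ e.+1) ^ 2)%N.
  rewrite -!expnM -!expnD (_ : a.+1 * 2 = a - e + (a - e) + e.+1 * 2)%N //.
  by move: le_ea; clear; lia.
have a_m' : (p ^ a %| m)%N by rewrite expnS dvdn_pmul2l in a_m.
have [dvd1 dvd2] := dvdz_binomials tau _ _ _ _ _ p_pr m_gt0 a_m' ne_l.
have e_pm : (p ^ e.+1 %| p * m)%N by apply: dvdn_trans a_m; rewrite dvdn_exp2l.
have e_pl : (p ^ e.+1 %| p * l)%N by rewrite expnS dvdn_pmul2l.
have := sgnz_ratio tau _ p e.+1 m l p_pr isT e_pm e_pl (erefl _).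
have co n : coprimez ((p ^ a.+1) ^ 2)%N%:Z (prime_to_fact p n).
  have := coprime_prime_to_fact p n p_pr.
  by rewrite !coprimezE !absz_nat -expnM => /(coprimeXl (a.+1 * 2)).
rewrite /signed_binomials !PoszM.
have -> : p%:Z * m%:Z * tau + p%:Z * l%:Z = p%:Z * (m%:Z * tau + l%:Z) by ring.
have -> : p%:Z * (m%:Z * tau + l%:Z) + p%:Z * m%:Z
          = p%:Z * (m%:Z * tau + l%:Z + m%:Z) by ring.
set x := m%:Z * tau + l%:Z; move=> ratio.
(* Both denominators are coprime to the modulus, so the difference may be multiplied by them. *)
rewrite -(Gauss_dvdzl _ (co (p * l)%N)) -(Gauss_dvdzl _ (co (p * m)%N)).
have def1 := bin_prime_to p m l p_gt0 m_gt0.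
have def2 := binz_prime_to p m x p_gt0 m_gt0.
set s := sgnz _ in ratio *; set s' := sgnz _ in ratio *.
rewrite (_ : _ * _ * _ =
    s * ('C(p * m, p * l)%:Z * prime_to_fact p (p * l)) *
      (binz (p%:Z * x - 1) (p * m).-1 * prime_to_fact p (p * m)) -
    s' * 'C(m, l)%:Z * binz (x - 1) m.-1 *
      (prime_to_fact p (p * l) * prime_to_fact p (p * m))); last by ring.
rewrite def1 def2.
set q1 := prime_to_ffact _ _ _ in ratio *; set q2 := prime_to_ffact _ _ _ in ratio *.
rewrite (_ : _ - _ = 'C(m, l)%:Z * binz (x - 1) m.-1 *
   (s * (q1 * q2) - s' * (prime_to_fact p (p * l) * prime_to_fact p (p * m))));
  last by ring.
by rewrite def_a PoszM; apply: dvdz_mul => //; rewrite PoszM; apply: dvdz_mul.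
Qed.

(** * Möbius sums, one prime at a time *)

Lemma moebius_sqr_dvd (p d : nat) : prime p -> (0 < d)%N -> (p ^ 2 %| d)%N ->
  moebius d = 0.
Proof.
move=> p_pr d_gt0; rewrite pfactor_dvdn // => log_gt1.
rewrite /moebius ifN //; apply/allPn; exists p; last by rewrite gtn_eqF.
by rewrite -logn_gt0 ltnW.
Qed.

Lemma moebius_mul_prime (p d : nat) : prime p -> (0 < d)%N -> ~~ (p %| d)%N ->
  moebius (p * d) = - moebius d.
Proof.
move=> p_pr d_gt0 npd; have p_gt0 := prime_gt0 p_pr.
have primes_pd : perm_eq (primes (p * d)) (p :: primes d).
  apply: uniq_perm; rewrite /= ?primes_uniq ?andbT //.
    by rewrite mem_primes (negPf npd) !andbF.
  by move=> q; rewrite primesM // (primes_prime p_pr) !inE.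
rewrite /moebius (perm_all _ primes_pd) (perm_size primes_pd) /=.
rewrite lognM // (pfactorK 1 p_pr : logn p p = 1%N) lognE (negPf npd) !andbF /=.
rewrite (_ : all _ _ = all (fun q => logn q d == 1%N) (primes d)).
  by case: all; rewrite ?oppr0 // exprS mulN1r.
apply: eq_in_all => q; rewrite mem_primes => /and3P[_ _ qd].
rewrite lognM // logn_prime // (_ : (q == p) = false) //.
by apply: contraNF npd => /eqP <-.
Qed.

(** Terms with [p^2] dividing [d] vanish; the others are indexed by [p c] with [c] prime to [p], and
    the sign flips. *)
Lemma sum_moebius_dvd (p g : nat) (F : nat -> int) :
  prime p -> (0 < g)%N -> (p %| g)%N ->
  \sum_(d <- divisors g | (p %| d)%N) moebius d * F d =
  - \sum_(d <- divisors g | ~~ (p %| d)%N) moebius d * F (p * d)%N.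
Proof.
move=> p_pr g_gt0 p_g; have p_gt0 := prime_gt0 p_pr.
rewrite (bigID (fun d => p ^ 2 %| d)%N) /= [X in X + _]big_seq_cond big1 ?add0r.
  2: by move=> d /and3P[]; rewrite -dvdn_divisors // => /(dvdn_gt0 g_gt0) d_gt0 _ p2d;
       rewrite (moebius_sqr_dvd p) ?mul0r.
rewrite -big_filter.
rewrite (perm_big [seq (p * d)%N | d <- divisors g & ~~ (p %| d)%N]) /=.
  rewrite big_map big_filter -sumrN big_seq_cond [RHS]big_seq_cond.
  apply: eq_bigr => d /andP[]; rewrite -dvdn_divisors // => /(dvdn_gt0 g_gt0) d_gt0 npd.
  by rewrite moebius_mul_prime // mulNr.
apply: uniq_perm.
- by rewrite filter_uniq ?divisors_uniq.
- rewrite map_inj_uniq ?filter_uniq ?divisors_uniq // => x y /eqP.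
  by rewrite eqn_pmul2l // => /eqP.
move=> d; rewrite mem_filter -dvdn_divisors //; apply/idP/mapP.
  move=> /andP[/andP[/dvdnP[c ->] np2] dg]; exists c; last by rewrite mulnC.
  rewrite mem_filter -dvdn_divisors // (dvdn_trans _ dg) ?dvdn_mulr // andbT.
  by rewrite expnS expn1 dvdn_pmul2r in np2.
case=> c; rewrite mem_filter -dvdn_divisors // => /andP[npc cg] ->.
rewrite expnS expn1 dvdn_pmul2l // npc dvdn_mulr //=.
by rewrite Gauss_dvd ?p_g // prime_coprime.
Qed.

Lemma dvdn_divn_coprime (p a d m : nat) : prime p -> ~~ (p %| d)%N -> (d %| m)%N ->
  (p ^ a %| m)%N -> (p ^ a %| m %/ d)%N.
Proof.
move=> p_pr npd dm am; rewrite -(Gauss_dvdl _ (_ : coprime _ d)) ?divnK //.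
by rewrite coprimeXl // prime_coprime.
Qed.

Lemma dvdz_sum_moebius (tau : int) (m l : nat) : (0 < m)%N ->
  ((m ^ 2)%N%:Z %| \sum_(d <- divisors (gcdn m l))
      moebius d * signed_binomials tau (m %/ d) (l %/ d))%Z.
Proof.
move=> m_gt0; set S := \sum_(d <- _) _.
have g_gt0 : (0 < gcdn m l)%N by rewrite gcdn_gt0 m_gt0.
rewrite dvdzE absz_nat; apply/dvdn_partP; first by rewrite expn_gt0 m_gt0.
move=> p; rewrite mem_primes => /andP[p_pr _].
rewrite partnX p_part; set a := logn p m.
have a_m : (p ^ a %| m)%N by exact: pfactor_dvdnn.
suff : (((p ^ a) ^ 2)%N%:Z %| S)%Z by rewrite dvdzE absz_nat.
rewrite /S (bigID (fun d => p %| d)%N) /=.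
have in_div d : d \in divisors (gcdn m l) -> ~~ (p %| d)%N ->
    [/\ (d %| m)%N, (d %| l)%N, (0 < m %/ d)%N & (p ^ a %| m %/ d)%N].
  rewrite -dvdn_divisors // dvdn_gcd => /andP[dm dl] npd; split=> //.
    by rewrite divn_gt0 ?(dvdn_leq m_gt0 dm) // (dvdn_gt0 m_gt0 dm).
  exact: dvdn_divn_coprime.
have [p_g | np_g] := boolP (p %| gcdn m l)%N.
  rewrite (sum_moebius_dvd _ _ (fun d => signed_binomials tau (m %/ d) (l %/ d))) //.
  (* The term of [d] is now paired with that of [p d], leaving a difference handled by
     [signed_binomials_mod]. *)
  rewrite addrC -sumrB big_seq_cond; apply: rpred_sum => d /andP[/in_div dvd_d npd].
  have [dm dl md_gt0 a_md] := dvd_d npd.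
  move: p_g; rewrite dvdn_gcd => /andP[pm pl].
  have p_div n : (d %| n)%N -> (p %| n)%N -> (p %| n %/ d)%N.
    by move=> dn; have := dvdn_divn_coprime p 1 d n p_pr npd dn; rewrite expn1.
  have pmd := p_div m dm pm; have pld := p_div l dl pl.
  rewrite -mulrBr; apply: dvdz_mull; rewrite [(p * d)%N]mulnC !divnMA.
  move: md_gt0 a_md; case/dvdnP: pmd => m' ->; case/dvdnP: pld => l' ->.
  rewrite !(mulnK _ (prime_gt0 p_pr)) !(mulnC _ p) muln_gt0 => /andP[_ m'_gt0] a_m'.
  exact: signed_binomials_mod.
rewrite big_seq_cond [X in (_ %| X + _)%Z]big1 ?add0r; last first.
  move=> d /andP[]; rewrite -dvdn_divisors // => dg pd.
  by rewrite (dvdn_trans pd dg) in np_g.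
rewrite big_seq_cond; apply: rpred_sum => d /andP[/in_div dvd_d npd].
have [dm dl md_gt0 a_md] := dvd_d npd.
have [a0 | a_gt0] := posnP a; first by rewrite a0 expn0 dvd1z.
have pm : (p %| m)%N by apply: dvdn_trans a_m; rewrite dvdn_exp.
have npl : ~~ (p %| l %/ d)%N.
  apply: contra np_g => pl; rewrite dvdn_gcd pm /=.
  by rewrite -(divnK dl) dvdn_mulr.
(* With [p] prime to [l / d], the choice [e = 0] gives the full [p^a] in each binomial. *)
have [|dvd1 dvd2] := dvdz_binomials tau p a 0 (m %/ d) (l %/ d) p_pr md_gt0 a_md.
  by rewrite expn1.
rewrite subn0 in dvd1 dvd2.
apply: dvdz_mull; rewrite /signed_binomials -mulrA; apply: dvdz_mull.
by rewrite -mulnn PoszM; apply: dvdz_mul.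
Qed.

(** * Return to the rational numbers *)

Lemma c_coefE (tau : int) (m l : nat) :
  c_coef tau m l = - (signed_binomials tau m l)%:~R / m%:R ^+ 2.
Proof.
rewrite /c_coef /signed_binomials expN1r -signr_odd -/(oddz _) addrAC.
by rewrite !rmorphM /= /sgnz rmorph_sign; ring.
Qed.

(** The denominators [d^2] and [(m / d)^2] multiply to [m^2] in every term. *)
Lemma n_invE (tau : int) (m l : nat) : (0 < m)%N ->
  n_inv tau m l = - (\sum_(d <- divisors (gcdn m l))
      moebius d * signed_binomials tau (m %/ d) (l %/ d))%:~R / m%:R ^+ 2.
Proof.
move=> m_gt0; have g_gt0 : (0 < gcdn m l)%N by rewrite gcdn_gt0 m_gt0.
rewrite /n_inv -big_filter (perm_big (divisors (gcdn m l))) /=; last first.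
  apply: uniq_perm; rewrite ?filter_uniq ?divisors_uniq // => d.
  by rewrite mem_filter -!dvdn_divisors // dvdn_gcd andbC.
rewrite rmorph_sum /= -sumrN mulr_suml big_seq [RHS]big_seq; apply: eq_bigr => d.
rewrite -dvdn_divisors // dvdn_gcd => /andP[dm _].
have d_gt0 := dvdn_gt0 m_gt0 dm.
have md_gt0 : (0 < m %/ d)%N by rewrite divn_gt0 // dvdn_leq.
rewrite c_coefE -[in X in _ = _ / X](divnK dm) natrM [in RHS]intrM.
by field; rewrite !pnatr_eq0 -!lt0n d_gt0.
Qed.

Theorem theorem4p5 (tau : int) (m l : nat) :
  (1 <= m)%N -> n_inv tau m l \is a Num.int.
Proof.
move=> m_gt0; rewrite n_invE //.
have /dvdzP[q ->] := dvdz_sum_moebius tau m l m_gt0.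
rewrite rmorphM /= -pmulrn natrX -mulNr mulfK ?rpredN ?intr_int //.
by rewrite expf_neq0 // pnatr_eq0 -lt0n.
Qed.
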